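(* Let $\mathcal P$ be a collection of probability measures on a measurable space $(\Omega,\mathcal F)$, and let $(Z_n)_{n=1}^\infty$ be a sequence of random variables on $(\Omega,\mathcal F)$ whose partial sums $S_n:=\sum_{i=1}^nZ_i$ form a $\mathcal P$-uniform Cauchy sequence that is $\mathcal P$-uniformly stochastically nonincreasing. Let $(b_n)_{n=1}^\infty$ be a positive, nondecreasing real sequence diverging to $\infty$. Then $b_n^{-1}\sum_{i=1}^nb_iZ_i$ vanishes $\mathcal P$-uniformly almost surely, i.e. for every $\varepsilon>0$, $$\lim_{m\to\infty}\sup_{P\in\mathcal P}P\left(\sup_{k\ge m}\left|\frac1{b_k}\sum_{i=1}^kb_iZ_i\right|\ge\varepsilon\right)=0.$$
   Context: A sequence $(Y_n)_{n=1}^\infty$ of random variables is a $\mathcal P$-uniform Cauchy sequence if for every $\varepsilon>0$, $\lim_{m\to\infty}\sup_{P\in\mathcal P}P(\sup_{k,n\ge m}|Y_k-Y_n|\ge\varepsilon)=0$. It is $\mathcal P$-uniformly stochastically nonincreasing if for every $\delta>0$ there exists $B_\delta>0$ such that for every $n\ge1$, $\sup_{P\in\mathcal P}P(|Y_n|\ge B_\delta)<\delta$. *)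

(* Defs.v *)
From HB Require Import structures.
From mathcomp Require Import all_boot all_order all_algebra.
From mathcomp Require Import all_classical all_reals all_analysis.

Set Implicit Arguments.
Unset Strict Implicit.
Unset Printing Implicit Defensive.

Import Order.TTheory GRing.Theory Num.Theory.
Import numFieldNormedType.Exports.

Local Open Scope classical_set_scope.
Local Open Scope ring_scope.

(* Sequences indexed by n >= 1 are functions on nat whose value at 0 is
   irrelevant.  Pathwise suprema are taken in \bar R, since they may be
   infinite. *)

(* For an empty Ps this is -oo (the supremum in \bar R). *)
Definition sup_prob (d : measure_display) (T : measurableType d)
    (R : realType) (Ps : set (probability T R)) (A : set T) : \bar R :=
  ereal_sup [set P A | P in Ps].

Definition uniform_cauchy (d : measure_display) (T : measurableType d)
    (R : realType) (Ps : set (probability T R)) (Y : nat -> T -> R) : Prop :=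
  forall eps : R, 0 < eps ->
    sup_prob Ps [set w | (eps%:E <=
        ereal_sup [set `|Y p.1 w - Y p.2 w|%:E
                  | p in [set p : nat * nat | (m <= p.1)%N /\ (m <= p.2)%N]])%E]
      @[m --> \oo] --> 0%E.

Definition uniform_stoch_nonincreasing (d : measure_display)
    (T : measurableType d) (R : realType) (Ps : set (probability T R))
    (Y : nat -> T -> R) : Prop :=
  forall delta : R, 0 < delta ->
    exists B : R, 0 < B /\
      forall n : nat, (1 <= n)%N ->
        (sup_prob Ps [set w | (B <= `|Y n w|)%R] < delta%:E)%E.

Definition uniform_vanish_as (d : measure_display) (T : measurableType d)
    (R : realType) (Ps : set (probability T R)) (Y : nat -> T -> R) : Prop :=
  forall eps : R, 0 < eps ->
    sup_prob Ps [set w | (eps%:E <=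
        ereal_sup [set `|Y k w|%:E | k in [set k : nat | (m <= k)%N]])%E]
      @[m --> \oo] --> 0%E.

(* Main.v *)
Require Import Defs.
From HB Require Import structures.
From mathcomp Require Import all_boot all_order all_algebra.
From mathcomp Require Import all_classical all_reals all_analysis.
From mathcomp Require Import measurable_realfun lra.

Import Order.TTheory GRing.Theory Num.Theory.
Import numFieldNormedType.Exports.

Local Open Scope classical_set_scope.
Local Open Scope ring_scope.

(** The proof is Kronecker's lemma made quantitative, so that it can be run
    on an event whose probability is controlled uniformly in [P].

    Write [S_n] for the partial sums.  Abel summation shows that if all
    partial sums of a block [z_m, ..., z_k] are bounded by [c], then the same
    sum with nonnegative nondecreasing weights [b] is at most [2 c b_k]
    ([abel_sum_le]).  Cut [\sum_(1 <= i <= k) b_i Z_i] at a fixed index [N].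
    Where the oscillation of [S] beyond [N] is below [eta], the block after
    [N] contributes at most [2 eta b_k]; where [|S_n| <= B] for [n <= N], the
    block up to [N] contributes at most [2 B b_N], which is below [eta b_k]
    as soon as [k] is large, since [b] diverges.  After division by [b_k] the
    mean is at most [3 eta] ([weighted_mean_le]).

    The order of choices gives uniformity: the Cauchy hypothesis yields [N]
    with exceptional probability below [delta / 2] for every [P]; stochastic
    boundedness, applied with level [delta / (2 N)], then yields a [B] for
    which the [N] exceptional events [|S_n| >= B], [n <= N], have total
    probability at most [delta / 2]; and the last threshold, on [k], is
    deterministic, hence does not depend on [P]. *)

(** Only the partial sums are controlled, not the terms [z i], so the weights
    have to be summed by parts: the sum is [b k * s k] minus the sum of
    [(b i.+1 - b i) * s i], and these increments of [b] are nonnegative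
    with total [b k - b m <= b k]. *)
Lemma abel_sum_le (R : realDomainType) (b z : nat -> R) (m k : nat) (c : R) :
  (m <= k)%N -> 0 <= b m ->
  (forall n, (m <= n < k)%N -> b n <= b n.+1) ->
  (forall n, (m <= n <= k)%N -> `|\sum_(m <= i < n.+1) z i| <= c) ->
  `|\sum_(m <= i < k.+1) b i * z i| <= 2 * c * b k.
Proof.
move=> mk bm0 bS zc.
(* The quantity bounded here is the Abel remainder; its increment from k' to
   k'.+1 is - (b k'.+1 - b k') times the partial sum up to k'. *)
have remainder k' : (m <= k' <= k)%N ->
    `|\sum_(m <= i < k'.+1) b i * z i - b k' * \sum_(m <= i < k'.+1) z i|
      <= c * (b k' - b m) /\ b m <= b k'.
  elim: k' => [|k' IH] /andP[mk' k'k].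
    move: mk'; rewrite leqn0 => /eqP ->.
    by rewrite !big_nat1 !subrr normr0 mulr0.
  move: mk'; rewrite leq_eqVlt => /predU1P[->|mk'].
    by rewrite !big_nat1 !subrr normr0 mulr0.
  have [IH1 IH2] := IH (introT andP (conj mk' (ltnW k'k))).
  have bk' := bS k' (introT andP (conj mk' k'k)).
  have sk' := zc k' (introT andP (conj mk' (ltnW k'k))).
  split; last exact: le_trans bk'.
  rewrite [X in X - _](big_nat_recr k'.+1)/= ?(ltnW mk')//.
  rewrite [X in _ - _ * X](big_nat_recr k'.+1)/= ?(ltnW mk')//.
  set s := \sum_(m <= i < k'.+1) z i in IH1 sk' *.
  set t := \sum_(m <= i < k'.+1) b i * z i in IH1 *.
  have -> : t + b k'.+1 * z k'.+1 - b k'.+1 * (s + z k'.+1)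
            = (t - b k' * s) - (b k'.+1 - b k') * s by lra.
  rewrite (le_trans (ler_normB _ _))// normrM [`|b _ - _|]ger0_norm ?subr_ge0//.
  have : (b k'.+1 - b k') * `|s| <= (b k'.+1 - b k') * c.
    by rewrite ler_wpM2l ?subr_ge0.
  lra.
have [r1 r2] := remainder k (introT andP (conj mk (leqnn k))).
have sk := zc k (introT andP (conj mk (leqnn k))).
have bk0 : 0 <= b k by exact: le_trans r2.
have : b k * `|\sum_(m <= i < k.+1) z i| <= b k * c by rewrite ler_wpM2l.
rewrite -{1}(ger0_norm bk0) -normrM => r3.
have c0 : 0 <= c by exact: le_trans sk.
have : 0 <= c * b m by exact: mulr_ge0.
have := ler_normD (\sum_(m <= i < k.+1) b i * z i -
   b k * \sum_(m <= i < k.+1) z i) (b k * \sum_(m <= i < k.+1) z i).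
rewrite subrK; lra.
Qed.

(** The pathwise Kronecker estimate: the tail beyond [N] is small because its
    partial sums are differences of the original ones.  The last hypothesis,
    which makes the initial block negligible, is what divergence of the
    weights supplies for large [k]. *)
Lemma weighted_mean_le (R : realFieldType) (b z : nat -> R) (N k : nat)
    (eta B : R) :
  (0 < N < k)%N ->
  (forall n, (1 <= n)%N -> 0 < b n) ->
  (forall m n, (1 <= m)%N -> (m <= n)%N -> b m <= b n) ->
  (forall n, (1 <= n <= N)%N -> `|\sum_(1 <= i < n.+1) z i| <= B) ->
  (forall n, (N <= n)%N ->
     `|\sum_(1 <= i < n.+1) z i - \sum_(1 <= i < N.+1) z i| <= eta) ->
  2 * B * b N <= eta * b k ->
  `|(b k)^-1 * \sum_(1 <= i < k.+1) b i * z i| <= 3 * eta.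
Proof.
move=> /andP[N0 Nk] b0 bS zB zeta Bk.
have bk0 : 0 < b k by rewrite b0// (leq_trans _ Nk).
rewrite normrM normfV (gtr0_norm bk0) ler_pdivrMl//.
rewrite (big_cat_nat (n := N.+1))//=; last exact: ltnW.
rewrite (le_trans (ler_normD _ _))//.
have head : `|\sum_(1 <= i < N.+1) b i * z i| <= 2 * B * b N.
  apply: abel_sum_le => //; first by rewrite ltW// b0.
  by move=> n /andP[n0 _]; apply: bS.
have tail : `|\sum_(N.+1 <= i < k.+1) b i * z i| <= 2 * eta * b k.
  apply: abel_sum_le => //; first by rewrite ltW// b0.
    by move=> n /andP[n0 _]; apply: bS => //; exact: leq_trans n0.
  move=> n /andP[Nn _]; have := zeta n (ltnW Nn).
  have -> : \sum_(1 <= i < n.+1) z i =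
      \sum_(1 <= i < N.+1) z i + \sum_(N.+1 <= i < n.+1) z i.
    by rewrite -big_cat_nat// ltnW.
  by rewrite addrAC subrr add0r.
lra.
Qed.

(** Monotonicity and subadditivity of a probability apply only to measurable
    events; the ones at hand are suprema over indices in [nat] and in
    [nat * nat], which is why the index type is an arbitrary countable one. *)
Lemma measurable_ereal_sup_ge (R : realType) (d : measure_display)
    (T : measurableType d) (I : countType) (D : set I) (f : I -> T -> \bar R)
    (c : \bar R) :
  (forall i, measurable_fun setT (f i)) ->
  measurable [set w | (c <= ereal_sup [set f i w | i in D])%E].
Proof.
move=> mf.
(* The family is reindexed by nat through the enumeration of I; the value -oo
   at the indices outside D does not affect the supremum. *)
pose g (n : nat) (w : T) : \bar R :=
  if unpickle n is Some i then if `[<D i>] then f i w else -oo%E else -oo%E.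
have mg n : measurable_fun setT (g n).
  rewrite /g; case: (unpickle n) => [i|]; last exact: measurable_cst.
  by case: (`[<D i>]); [exact: mf|exact: measurable_cst].
have supE w : ereal_sup [set f i w | i in D] = esups (g^~ w) 0%N.
  apply/eqP; rewrite eq_le; apply/andP; split; apply: ge_ereal_sup.
    move=> _ [i Di <-]; apply: ereal_sup_ubound; exists (pickle i) => //=.
    by rewrite /g pickleK; case: asboolP.
  move=> _ [n _ <-]; rewrite /g; case: (unpickle n) => [i|]; last exact: leNye.
  case: asboolP => [Di|_]; last exact: leNye.
  by apply: ereal_sup_ubound; exists i.
rewrite (_ : [set w | _] =
    setT `&` [set w | (c <= esups (g^~ w) 0%N)%E]); last first.
  by rewrite setTI; apply/seteqP; split=> w /=; rewrite supE.
apply: emeasurable_fun_c_infty => //.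
exact: measurable_fun_esups.
Qed.

Lemma sup_prob_cvg0_lt (d : measure_display) (T : measurableType d)
    (R : realType) (Ps : set (probability T R)) (A : nat -> set T) (delta : R) :
  sup_prob Ps (A m) @[m --> \oo] --> 0%E -> 0 < delta ->
  \forall m \near \oo, (sup_prob Ps (A m) < delta%:E)%E.
Proof.
move=> /fine_cvgP[fin /cvgr0Pnorm_lt cv] delta0.
near=> m.
have mfin : sup_prob Ps (A m) \is a fin_num by near: m.
rewrite -(fineK mfin) lte_fin (le_lt_trans (ler_norm _))//.
by near: m; exact: cv.
Unshelve. all: by end_near. Qed.

(** Nonemptiness of the family makes its supremum nonnegative; with the upper
    bounds this gives convergence in the extended reals. *)
Lemma sup_prob_cvg0 (d : measure_display) (T : measurableType d)
    (R : realType) (Ps : set (probability T R)) (A : nat -> set T) :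
  Ps !=set0 ->
  (forall delta : R, 0 < delta ->
     \forall m \near \oo, (sup_prob Ps (A m) <= delta%:E)%E) ->
  sup_prob Ps (A m) @[m --> \oo] --> 0%E.
Proof.
move=> [P PsP] small.
have ge0 m : (0 <= sup_prob Ps (A m))%E.
  apply: (le_trans (measure_ge0 P (A m))).
  by apply: ereal_sup_ubound; exists P.
have fin delta m : (sup_prob Ps (A m) <= delta%:E)%E ->
    sup_prob Ps (A m) \is a fin_num.
  by move=> le; rewrite ge0_fin_numE// (le_lt_trans le)// ltry.
apply/fine_cvgP; split.
  by apply: filterS (small 1 ltr01) => m; exact: fin.
apply/cvgr0Pnorm_le => delta delta0.
apply: filterS (small _ delta0) => m le.
rewrite ger0_norm ?fine_ge0// -lee_fin fineK//.
exact: fin le.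
Qed.

Theorem lemma1 (R : realType) (d : measure_display) (T : measurableType d)
    (Ps : set (probability T R)) (Z : nat -> {mfun T >-> R})
    (hcauchy : uniform_cauchy Ps
                 (fun n w => \sum_(1 <= i < n.+1) Z i w))
    (hstoch : uniform_stoch_nonincreasing Ps
                (fun n w => \sum_(1 <= i < n.+1) Z i w))
    (b : nat -> R)
    (b_gt0 : forall n : nat, (1 <= n)%N -> 0 < b n)
    (b_nondecreasing : forall m n : nat, (1 <= m)%N -> (m <= n)%N -> b m <= b n)
    (b_oo : b n @[n --> \oo] --> +oo) :
  uniform_vanish_as Ps
    (fun k w => (b k)^-1 * \sum_(1 <= i < k.+1) b i * Z i w).
Proof.
have mS (n : nat) :
    measurable_fun setT (fun w => \sum_(1 <= i < n.+1) Z i w).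
  by apply: measurable_sum => i; exact: measurable_funP.
(* For an empty family the supremum is -oo, which does not tend to 0. *)
have Ps0 : Ps !=set0.
  apply/set0P/eqP => Ps0.
  have /fine_cvgP[[n _ fin] _] := hcauchy 1 ltr01.
  by move: (fin n (leqnn n)); rewrite /sup_prob Ps0 /= image_set0 ereal_sup0.
move=> eps eps0; apply: sup_prob_cvg0 => // delta delta0.
(* Paths outside the exceptional events are bounded by 3 * eta, which must be
   strictly below eps. *)
pose eta := eps / 4.
have eta0 : 0 < eta by rewrite /eta; lra.
have delta20 : 0 < delta / 2 by lra.
have [N0 _ HN0] := sup_prob_cvg0_lt _ _ _ _ _ _ (hcauchy _ eta0) delta20.
(* The successor makes N positive, as required for b N and for delta / 2 / N. *)
pose N := N0.+1.
have /= {HN0} := HN0 N (leqnSn N0).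
set A := [set w | _] => HA.
have deltaN0 : 0 < delta / 2 / N%:R by rewrite divr_gt0// ltr0n.
have [B [B0 HB]] := hstoch _ deltaN0.
pose E n := [set w | B <= `|\sum_(1 <= i < n.+2) Z i w|].
have mA : measurable A.
  apply: measurable_ereal_sup_ge => p.
  apply/measurable_EFinP; apply: measurableT_comp => //.
  exact: measurable_funB.
have mE n : measurable (E n).
  rewrite /E -[X in measurable X]setTI.
  apply: measurable_fun_le => //.
  exact: measurableT_comp.
near=> m.
apply: ge_ereal_sup => _ [P PsP <-].
have sub : [set w | (eps%:E <= ereal_sup
      [set `|(b k)^-1 * \sum_(1 <= i < k.+1) b i * Z i w|%:E
        | k in [set k | (m <= k)%N]])%E] `<=`
    A `|` \big[setU/set0]_(n < N) E n.
  move=> w /=; apply: contraPP => /not_orP[/negP nA /= nE].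
  apply/negP; rewrite -ltNge in nA; rewrite -ltNge.
  apply: (@le_lt_trans _ _ (3 * eta)%:E); last first.
    by rewrite lte_fin /eta; lra.
  apply: ge_ereal_sup => _ [k /= mk <-]; rewrite lee_fin.
  apply: (weighted_mean_le _ _ _ N _ _ B) => //.
  - by rewrite /= (leq_trans _ mk)//; near: m; exact: nbhs_infty_gt.
  - move=> [//|n] /andP[_ nN]; rewrite ltW// ltNge; apply/negP => En.
    apply: nE; rewrite -bigcup_mkord; exists n => //.
  - move=> n Nn; rewrite -lee_fin (le_trans _ (ltW nA))//.
    by apply: ereal_sup_ubound; exists (n, N).
  - have : 2 * B * b N / eta <= b k.
      apply: (@le_trans _ _ (b m)).
        by near: m; move/cvgryPge : b_oo; exact.
      by apply: b_nondecreasing => //; near: m; exact: nbhs_infty_ge.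
    by rewrite ler_pdivrMr// [b k * _]mulrC.
have mU : measurable (\big[setU/set0]_(n < N) E n).
  by apply: bigsetU_measurable => n _; exact: mE.
apply: le_trans (le_measure P _ _ sub) _.
- rewrite inE; apply: measurable_ereal_sup_ge => k.
  apply/measurable_EFinP; apply: measurableT_comp => //.
  apply: measurable_funM => //; apply: measurable_sum => i.
  by apply: measurable_funM => //; exact: measurable_funP.
- by rewrite inE; exact: measurableU.
apply: le_trans (measureU2 P mA mU) _.
rewrite [delta]splitr EFinD leeD//.
  by apply: le_trans (ltW HA); apply: ereal_sup_ubound; exists P.
apply: le_trans (Boole_inequality P (fun i _ => mE i)) _.
apply: (@le_trans _ _ (\sum_(n < N) (delta / 2 / N%:R)%:E)%E).
  apply: lee_sum => n _; apply: le_trans (ltW (HB n.+1 isT)).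
  by apply: ereal_sup_ubound; exists P.
rewrite sumEFin lee_fin sumr_const card_ord -[_ *+ _]mulr_natr divfK//.
by rewrite pnatr_eq0.
Unshelve. all: by end_near. Qed.
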